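(* Let $\psi\colon G\twoheadrightarrow H$ be an epimorphism of commutative groups, let $R$ be a $G$-graded ring, and let $M$ be a $G$-graded $R$-module. Then the canonical monomorphism of functors $h_{\psi}^M\colon{}^{G}\mathrm{Hom}_{R}(M,\bullet)_{[\psi]}\rightarrowtail{}^{H}\mathrm{Hom}_{R_{[\psi]}}(M_{[\psi]},\bullet_{[\psi]})$ is an isomorphism if and only if $M$ is small or $\operatorname{Ker}(\psi)$ is finite.
   Context: All groups and rings are commutative; groups are written additively. A $G$-graded ring is a ring $R$ with a family $(R_g)_{g\in G}$ of additive subgroups such that $R=\bigoplus_{g\in G}R_g$ and $R_gR_h\subseteq R_{g+h}$ for $g,h\in G$. A $G$-graded $R$-module is an $R$-module $M$ with a family $(M_g)_{g\in G}$ of additive subgroups such that $M=\bigoplus_{g\in G}M_g$ and $R_gM_h\subseteq M_{g+h}$ for $g,h\in G$. $\mathsf{GrMod}^G(R)$ is the category of $G$-graded $R$-modules whose morphisms are the $R$-linear maps $u\colon M\rightarrow N$ with $u(M_g)\subseteq N_g$ for all $g\in G$. For $g\in G$, $N(g)$ denotes the shift of $N$ by $g$: $N(g)_a=N_{a+g}$ for $a\in G$. $\psi$-coarsening: $R_{[\psi]}$ is the $H$-graded ring with the same underlying ring as $R$ and with component $\bigoplus_{g\in\psi^{-1}(h)}R_g$ in degree $h\in H$; for a $G$-graded $R$-module $M$, $M_{[\psi]}$ is the $H$-graded $R_{[\psi]}$-module with the same underlying module and with component $\bigoplus_{g\in\psi^{-1}(h)}M_g$ in degree $h\in H$; on morphisms,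 $u_{[\psi]}$ has the same underlying map as $u$. Graded Hom: ${}^{G}\mathrm{Hom}_{R}(M,N)=\bigoplus_{g\in G}\mathrm{Hom}_{\mathsf{GrMod}^G(R)}(M,N(g))$, a $G$-graded $R$-module whose component of degree $g$ is $\mathrm{Hom}_{\mathsf{GrMod}^G(R)}(M,N(g))$; analogously for $H$ and $R_{[\psi]}$. For a $G$-graded $R$-module $N$, the monomorphisms of groups $\mathrm{Hom}_{\mathsf{GrMod}^G(R)}(M,N(g))\rightarrowtail\mathrm{Hom}_{\mathsf{GrMod}^H(R_{[\psi]})}(M_{[\psi]},N_{[\psi]}(\psi(g)))$, $u\mapsto u_{[\psi]}$, for $g\in G$ induce a monomorphism $h_{\psi}^M(N)\colon{}^{G}\mathrm{Hom}_{R}(M,N)_{[\psi]}\rightarrowtail{}^{H}\mathrm{Hom}_{R_{[\psi]}}(M_{[\psi]},N_{[\psi]})$ in $\mathsf{GrMod}^H(R_{[\psi]})$, natural in $N$; this defines $h_\psi^M$. Small: $M$ is called small if for every set $I$ and every family $(N_i)_{i\in I}$ of $G$-graded $R$-modules the canonical monomorphism of groups $\bigoplus_{i\in I}\mathrm{Hom}_{\mathsf{GrMod}^G(R)}(M,N_i)\rightarrow\mathrm{Hom}_{\mathsf{GrMod}^G(R)}(M,\bigoplus_{i\in I}N_i)$ (induced by the canonical injections $N_j\rightarrowtail\bigoplus_{i\in I}N_i$) is an isomorphism. *)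

(* Defs.v *)
From HB Require Import structures.
From mathcomp Require Import all_boot all_order all_algebra finmap.
From mathcomp Require Import all_classical.

Set Implicit Arguments.
Unset Strict Implicit.
Unset Printing Implicit Defensive.

Import GRing.Theory.
Local Open Scope classical_set_scope.
Local Open Scope ring_scope.

(* Families of finite support and their sums. The library sum over a set is 0
   when the support is infinite; below it is used for finite supports only. *)

Definition finsupp (I : Type) (V : I -> zmodType) (f : forall i, V i) : Prop :=
  finite_set [set i | f i != 0].

Section FiniteSums.
Variables (I : choiceType) (V : zmodType).
Implicit Types (f : I -> V) (r : seq I).

Lemma finsuppP (W : I -> zmodType) (f : forall i, W i) :
  finsupp f <-> exists2 r, uniq r & forall i, i \notin r -> f i = 0.
Proof.
split=> [/finite_fsetP[X XE]|[r ur rf]].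
  exists (enum_fset X) => [|i iX]; first exact: fset_uniq.
  apply: contraNeq iX => fi0; have : [set` X] i by rewrite -XE.
  by [].
apply: (@sub_finite_set _ _ [set` r]); last exact: finite_seq.
move=> i /= fi0; apply: contraNT fi0 => /rf ->; by rewrite eqxx.
Qed.

Lemma finsuppS r (W : I -> zmodType) (f : forall i, W i) :
  (forall i, i \notin r -> f i = 0) -> finsupp f.
Proof.
move=> rf; apply/finsuppP; exists (undup r); first exact: undup_uniq.
by move=> i; rewrite mem_undup; exact: rf.
Qed.

Lemma fsumE (A : set I) r f : uniq r -> (forall i, i \notin r -> f i = 0) ->
  \sum_(i \in A) f i = \sum_(i <- r | i \in A) f i.
Proof.
move=> ur rf; rewrite (bigfs _ ur (fun i _ => rf i)).
by apply: eq_fsbigl; rewrite set_mem_set.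
Qed.

Lemma fsumTE r f : uniq r -> (forall i, i \notin r -> f i = 0) ->
  \sum_(i \in [set: I]) f i = \sum_(i <- r) f i.
Proof.
by move=> ur rf; rewrite (fsumE _ ur rf); apply: eq_bigl => i; rewrite in_setT.
Qed.

Lemma fsumD (A : set I) f1 f2 : finsupp f1 -> finsupp f2 ->
  \sum_(i \in A) (f1 i + f2 i) = \sum_(i \in A) f1 i + \sum_(i \in A) f2 i.
Proof.
move=> /finsuppP[r1 _ h1] /finsuppP[r2 _ h2].
pose r := undup (r1 ++ r2); have ur : uniq r by exact: undup_uniq.
have hr i : i \notin r -> f1 i = 0 /\ f2 i = 0.
  by rewrite mem_undup mem_cat negb_or => /andP[/h1 -> /h2 ->].
rewrite !(fsumE _ ur) ?big_split // => i /hr[e1 e2]; rewrite ?e1 ?e2 //.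
exact: addr0.
Qed.

Lemma fsumB (A : set I) f1 f2 : finsupp f1 -> finsupp f2 ->
  \sum_(i \in A) (f1 i - f2 i) = \sum_(i \in A) f1 i - \sum_(i \in A) f2 i.
Proof.
move=> /finsuppP[r1 _ h1] /finsuppP[r2 _ h2].
pose r := undup (r1 ++ r2); have ur : uniq r by exact: undup_uniq.
have hr i : i \notin r -> f1 i = 0 /\ f2 i = 0.
  by rewrite mem_undup mem_cat negb_or => /andP[/h1 -> /h2 ->].
rewrite !(fsumE _ ur) ?sumrB // => i /hr[e1 e2]; rewrite ?e1 ?e2 //.
exact: subrr.
Qed.

Lemma fsum1 (a : I) f : (forall i, i != a -> f i = 0) ->
  \sum_(i \in [set: I]) f i = f a.
Proof.
move=> h; rewrite (@fsumTE [:: a]) ?big_seq1 // => i; rewrite inE; exact: h.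
Qed.

Lemma fsum_ind (P : V -> Prop) (A : set I) f :
  P 0 -> (forall x y, P x -> P y -> P (x + y)) ->
  (forall i, A i -> P (f i)) -> P (\sum_(i \in A) f i).
Proof.
move=> P0 PD Pf; rewrite fsbig_mkcond; elim/big_ind: _ => // i _.
rewrite /patch; case: ifPn => // /set_mem; exact: Pf.
Qed.

End FiniteSums.

Lemma fsum_morph (I : choiceType) (V W : zmodType) (h : V -> W) (A : set I)
    (f : I -> V) :
  zmod_morphism h -> finsupp f ->
  h (\sum_(i \in A) f i) = \sum_(i \in A) h (f i).
Proof.
move=> hB /finsuppP[r ur rf].
have h0 : h 0 = 0 by rewrite -[0 in LHS](subrr 0) hB subrr.
have hD x y : h (x + y) = h x + h y.
  by rewrite -[y in LHS]opprK -[- y]add0r !hB h0 sub0r opprK.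
have rhf i : i \notin r -> h (f i) = 0 by move=> /rf ->.
rewrite (fsumE A ur rf) (fsumE A ur rhf).
by elim/big_rec2: _ => // i x y _ <-; rewrite hD.
Qed.

Lemma finsupp_comp (I J : choiceType) (V : zmodType) (f : I -> V) (h : J -> I) :
  injective h -> finsupp f -> finsupp (fun j => f (h j)).
Proof.
by move=> hi ff; apply: (finite_preimage _ ff) => x y _ _ /hi.
Qed.

Lemma fsum_exchange (I J : choiceType) (V : zmodType) (f : I -> J -> V)
    (r : seq I) (s : seq J) :
  (forall i j, (i \notin r) || (j \notin s) -> f i j = 0) ->
  \sum_(i \in [set: I]) \sum_(j \in [set: J]) f i j =
  \sum_(j \in [set: J]) \sum_(i \in [set: I]) f i j.
Proof.
move=> h; pose r' := undup r; pose s' := undup s.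
have ur : uniq r' by exact: undup_uniq.
have us : uniq s' by exact: undup_uniq.
have h' i j : (i \notin r') || (j \notin s') -> f i j = 0.
  by rewrite !mem_undup; exact: h.
have E1 i : \sum_(j \in [set: J]) f i j = \sum_(j <- s') f i j.
  by apply: fsumTE => // j js; rewrite h' // js orbT.
have E2 j : \sum_(i \in [set: I]) f i j = \sum_(i <- r') f i j.
  by apply: fsumTE => // i ir; rewrite h' // ir.
rewrite (@fsumTE _ _ r') // => [|i ir]; last first.
  by rewrite E1 big1 // => j _; rewrite h' // ir.
rewrite (@fsumTE _ _ s') // => [|j js]; last first.
  by rewrite E2 big1 // => i _; rewrite h' // js orbT.
under eq_bigr do rewrite E1; under [RHS]eq_bigr do rewrite E2.
exact: exchange_big.
Qed.

Lemma fsum_fibers (I J : choiceType) (V : zmodType) (p : I -> J) (f : I -> V) :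
  finsupp f ->
  finsupp (fun j => \sum_(i \in p @^-1` [set j]) f i) /\
  \sum_(j \in [set: J]) \sum_(i \in p @^-1` [set j]) f i =
  \sum_(i \in [set: I]) f i.
Proof.
move=> /finsuppP[r ur rf].
have E j : \sum_(i \in p @^-1` [set j]) f i = \sum_(i <- r | p i == j) f i.
  rewrite (fsumE _ ur rf); apply: eq_bigl => i.
  by apply/idP/eqP => [/set_mem //|pi]; apply/mem_set.
have sE j : j \notin undup (map p r) ->
    \sum_(i \in p @^-1` [set j]) f i = 0.
  rewrite mem_undup => jr.
  rewrite E big_seq_cond big1 // => i /andP[ir /eqP pi].
  by rewrite -pi map_f in jr.
split; first exact: finsuppS sE.
rewrite (fsumTE (undup_uniq _) sE) (fsumTE ur rf).
under eq_bigr do rewrite E big_mkcond.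
rewrite exchange_big /= big_seq [RHS]big_seq; apply: eq_bigr => i ir.
rewrite -big_mkcond (big_rem (p i)) /= ?mem_undup ?map_f // eqxx.
rewrite big_seq_cond big1 ?addr0 // => j.
rewrite (rem_filter _ (undup_uniq _)) mem_filter /= => /andP[/andP[]].
by rewrite eq_sym => /negbTE ->.
Qed.

(* A grading of V : the additive group V is the direct sum of the subgroups
   [gr g], i.e. every element is in exactly one way the sum of a finitely
   supported family of elements of the subgroups. *)
Record grading (G V : zmodType) := Grading {
  gr :> G -> set V;
  gr0 : forall g, gr g 0;
  grB : forall g x y, gr g x -> gr g y -> gr g (x - y);
  gr_direct : forall x, exists! f : G -> V,
    [/\ finsupp f, forall g, gr g (f g) & x = \sum_(g \in [set: G]) f g] }.

Record gradedRing (G : zmodType) := GradedRing {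
  gring_sort :> comPzRingType;
  gring_gr : grading G gring_sort;
  gring_mul : forall g h (r s : gring_sort),
    gring_gr g r -> gring_gr h s -> gring_gr (g + h) (r * s) }.

Record gradedModule (G : zmodType) (R : gradedRing G) := GradedModule {
  gmod_sort :> lmodType R;
  gmod_gr : grading G gmod_sort;
  gmod_scale : forall g h (r : R) (x : gmod_sort),
    gring_gr R g r -> gmod_gr h x -> gmod_gr (g + h) (r *: x) }.

Section GradingTheory.
Variables (G V : zmodType) (X : grading G V).
Implicit Types (x y : V) (g h : G).

Lemma grN g x : X g x -> X g (- x).
Proof. by move=> ?; rewrite -sub0r; apply: grB => //; exact: gr0. Qed.

Lemma grD g x y : X g x -> X g y -> X g (x + y).
Proof. by move=> ? ?; rewrite -[y]opprK; apply: grB => //; exact: grN. Qed.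

Definition gproj g x : V := sval (cid (gr_direct X x)) g.

Lemma gprojP x :
  [/\ finsupp (gproj^~ x), forall g, X g (gproj g x) &
      x = \sum_(g \in [set: G]) gproj g x].
Proof. by rewrite /gproj; case: cid => f []. Qed.

Lemma gproj_uniq x f : finsupp f -> (forall g, X g (f g)) ->
  x = \sum_(g \in [set: G]) f g -> forall g, gproj g x = f g.
Proof.
move=> ff Xf xE g; rewrite /gproj; case: cid => f' [_ /(_ f)] /= -> //.
Qed.

Lemma gproj_fin x : finsupp (gproj^~ x). Proof. by case: (gprojP x). Qed.
Lemma gproj_gr g x : X g (gproj g x). Proof. by case: (gprojP x). Qed.
Lemma gproj_sum x : \sum_(g \in [set: G]) gproj g x = x.
Proof. by case: (gprojP x). Qed.

Lemma gprojB g : zmod_morphism (gproj g).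
Proof.
move=> x y; pose f g := gproj g x - gproj g y.
apply: (@gproj_uniq (x - y) f).
- have /finsuppP[r _ rf] := gproj_fin x; have /finsuppP[s _ sf] := gproj_fin y.
  apply: (@finsuppS _ (r ++ s)) => i; rewrite mem_cat negb_or /f.
  by move=> /andP[/rf -> /sf ->]; rewrite subrr.
- by move=> h; apply: grB; exact: gproj_gr.
- by rewrite fsumB ?gproj_sum //; exact: gproj_fin.
Qed.

Lemma gproj0 g : gproj g 0 = 0.
Proof. by rewrite -[0 in LHS](subrr 0) gprojB subrr. Qed.

Lemma gprojD g x y : gproj g (x + y) = gproj g x + gproj g y.
Proof. by rewrite -[y in LHS]opprK -[- y]add0r !gprojB gproj0 sub0r opprK. Qed.

Lemma gproj_hom g h x : X h x -> gproj g x = if g == h then x else 0.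
Proof.
move=> Xx; apply: (@gproj_uniq x (fun g => if g == h then x else 0)).
- by apply: (@finsuppS _ [:: h]) => i; rewrite inE => /negbTE ->.
- by move=> k; case: eqP => [->//|_]; exact: gr0.
- by rewrite (@fsum1 _ _ h) ?eqxx // => i /negbTE ->.
Qed.

Lemma gr_sum (I : choiceType) (A : set I) g (f : I -> V) :
  (forall i, A i -> X g (f i)) -> X g (\sum_(i \in A) f i).
Proof. by move=> Xf; apply: fsum_ind => //; [exact: gr0|exact: grD]. Qed.

Lemma gr_ind (P : V -> Prop) :
  P 0 -> (forall x y, P x -> P y -> P (x + y)) ->
  (forall g x, X g x -> P x) -> forall x, P x.
Proof.
move=> P0 PD PX x; rewrite -(gproj_sum x); apply: fsum_ind => // g _.
exact: PX (gproj_gr g x).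
Qed.

Lemma gproj_eq0 x : (forall g, gproj g x = 0) -> x = 0.
Proof. by move=> x0; rewrite -(gproj_sum x) fsbig1. Qed.

End GradingTheory.

Section GradedHom.
Variables (G : zmodType) (R : gradedRing G).
Implicit Types M N P : gradedModule R.

Record grHom M N := GrHom {
  grHom_fun :> M -> N;
  grHom_linear : linear grHom_fun;
  grHom_gr : forall g x, gmod_gr M g x -> gmod_gr N g (grHom_fun x) }.

Lemma grHomP M N (u v : grHom M N) : u =1 v -> u = v.
Proof.
case: u v => [u lu du] [v lv dv] /= /funext uv; subst v.
by congr GrHom; exact: Prop_irrelevance.
Qed.

Section Zmod.
Variables M N : gradedModule R.

HB.instance Definition _ := gen_eqMixin (grHom M N).
HB.instance Definition _ := gen_choiceMixin (grHom M N).
HB.instance Definition _ (u : grHom M N) :=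
  GRing.isLinear.Build R M N *:%R u (@grHom_linear M N u).

Lemma grHom_zero_linear : linear (fun _ : M => 0 : N).
Proof. by move=> a x y; rewrite scaler0 addr0. Qed.

Definition grHom_zero : grHom M N :=
  GrHom grHom_zero_linear (fun g _ _ => gr0 (gmod_gr N) g).

Lemma grHom_opp_linear (u : grHom M N) : linear (fun x : M => - u x).
Proof. by move=> a x y; rewrite linearP opprD scalerN. Qed.

Definition grHom_opp (u : grHom M N) : grHom M N :=
  GrHom (@grHom_opp_linear u) (fun g x Mx => grN (grHom_gr u Mx)).

Lemma grHom_add_linear (u v : grHom M N) : linear (fun x : M => u x + v x).
Proof. by move=> a x y; rewrite !linearP addrACA scalerDr. Qed.

Definition grHom_add (u v : grHom M N) : grHom M N :=
  GrHom (@grHom_add_linear u v)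
    (fun g x Mx => grD (grHom_gr u Mx) (grHom_gr v Mx)).

Lemma grHom_addA : associative grHom_add.
Proof. by move=> u v w; apply: grHomP => x /=; rewrite addrA. Qed.
Lemma grHom_addC : commutative grHom_add.
Proof. by move=> u v; apply: grHomP => x /=; rewrite addrC. Qed.
Lemma grHom_add0 : left_id grHom_zero grHom_add.
Proof. by move=> u; apply: grHomP => x /=; rewrite add0r. Qed.
Lemma grHom_addN : left_inverse grHom_zero grHom_opp grHom_add.
Proof. by move=> u; apply: grHomP => x /=; rewrite addNr. Qed.

HB.instance Definition _ := GRing.isZmodule.Build (grHom M N)
  grHom_addA grHom_addC grHom_add0 grHom_addN.

Lemma grHomD (u : grHom M N) x y : u (x + y) = u x + u y.
Proof. exact: linearD. Qed.
Lemma grHomB (u : grHom M N) : zmod_morphism u. Proof. exact: linearB. Qed.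
Lemma grHom0 (u : grHom M N) : u 0 = 0. Proof. exact: linear0. Qed.
Lemma grHomZ (u : grHom M N) a x : u (a *: x) = a *: u x.
Proof. exact: linearZ. Qed.
Lemma grHom0E (x : M) : (0 : grHom M N) x = 0. Proof. by []. Qed.
Lemma grHomDE (u v : grHom M N) x : (u + v) x = u x + v x. Proof. by []. Qed.
Lemma grHomBE (u v : grHom M N) x : (u - v) x = u x - v x. Proof. by []. Qed.

End Zmod.

Definition grHom_id M : grHom M M :=
  @GrHom M M id (fun a x y => erefl) (fun g x Mx => Mx).

Lemma grHom_comp_linear M N P (v : grHom N P) (u : grHom M N) :
  linear (fun x => v (u x)).
Proof. by move=> a x y; rewrite !linearP. Qed.

Definition grHom_comp M N P (v : grHom N P) (u : grHom M N) : grHom M P :=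
  GrHom (@grHom_comp_linear M N P v u)
    (fun g x Mx => grHom_gr v (grHom_gr u Mx)).

End GradedHom.

Section DirectSum.
Variables (I : choiceType) (V : I -> zmodType).

Record dsum := Dsum {
  dsum_fun :> forall i, V i;
  dsum_fin : finsupp dsum_fun }.

Lemma dsumP (u v : dsum) : (forall i, u i = v i) -> u = v.
Proof.
case: u v => [u fu] [v fv] /= uv.
have {uv} E : u = v by apply: functional_extensionality_dep.
by subst v; congr Dsum; exact: Prop_irrelevance.
Qed.

HB.instance Definition _ := gen_eqMixin dsum.
HB.instance Definition _ := gen_choiceMixin dsum.

Lemma dsum_zero_fin : finsupp (fun i => 0 : V i).
Proof. by apply: (@finsuppS _ [::]). Qed.

Definition dsum_zero := Dsum dsum_zero_fin.

Lemma dsum_opp_fin (u : dsum) : finsupp (fun i => - u i).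
Proof.
have /finsuppP[r _ rf] := dsum_fin u.
by apply: (@finsuppS _ r) => i /rf ->; rewrite oppr0.
Qed.

Definition dsum_opp (u : dsum) := Dsum (@dsum_opp_fin u).

Lemma dsum_add_fin (u v : dsum) : finsupp (fun i => u i + v i).
Proof.
have /finsuppP[r _ rf] := dsum_fin u; have /finsuppP[s _ sf] := dsum_fin v.
apply: (@finsuppS _ (r ++ s)) => i; rewrite mem_cat negb_or.
by move=> /andP[/rf -> /sf ->]; rewrite addr0.
Qed.

Definition dsum_add (u v : dsum) := Dsum (@dsum_add_fin u v).

Lemma dsum_addA : associative dsum_add.
Proof. by move=> u v w; apply: dsumP => i /=; rewrite addrA. Qed.
Lemma dsum_addC : commutative dsum_add.
Proof. by move=> u v; apply: dsumP => i /=; rewrite addrC. Qed.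
Lemma dsum_add0 : left_id dsum_zero dsum_add.
Proof. by move=> u; apply: dsumP => i /=; rewrite add0r. Qed.
Lemma dsum_addN : left_inverse dsum_zero dsum_opp dsum_add.
Proof. by move=> u; apply: dsumP => i /=; rewrite addNr. Qed.

HB.instance Definition _ := GRing.isZmodule.Build dsum
  dsum_addA dsum_addC dsum_add0 dsum_addN.

Lemma dsumDE (u v : dsum) i : (u + v) i = u i + v i. Proof. by []. Qed.
Lemma dsumBE (u v : dsum) i : (u - v) i = u i - v i. Proof. by []. Qed.

Lemma dsum_inj_fin i (x : V i) : finsupp (dfwith (fun j => 0 : V j) i x).
Proof.
apply: (@finsuppS _ [:: i]) => j; rewrite inE => ji.
by rewrite dfwithout // eq_sym.
Qed.

Definition dsum_inj (i : I) (x : V i) : dsum := Dsum (@dsum_inj_fin i x).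
Arguments dsum_inj : clear implicits.

Lemma dsum_inj_in i (x : V i) : dsum_inj i x i = x.
Proof. exact: dfwithin. Qed.

Lemma dsum_inj_out i j (x : V i) : j != i -> dsum_inj i x j = 0.
Proof. by move=> ji; rewrite /= dfwithout // eq_sym. Qed.

Lemma dsum_injB i : zmod_morphism (dsum_inj i).
Proof.
move=> x y; apply: dsumP => j; rewrite dsumBE.
by have [->|ji] := eqVneq j i; rewrite ?dsum_inj_in // !dsum_inj_out // subrr.
Qed.

(* The group homomorphism induced by a family of group homomorphisms. *)
Definition dsum_induced (W : zmodType) (f : forall i, V i -> W) (u : dsum) :
    W :=
  \sum_(i \in [set: I]) f i (u i).

Lemma dsum_induced_fin (W : zmodType) (f : forall i, V i -> W) (u : dsum) :
  (forall i, zmod_morphism (f i)) -> finsupp (fun i => f i (u i)).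
Proof.
move=> fB; have /finsuppP[r _ rf] := dsum_fin u.
by apply: (@finsuppS _ r) => i /rf ->; rewrite -(subrr 0) fB subrr.
Qed.

Lemma dsum_inducedB (W : zmodType) (f : forall i, V i -> W) :
  (forall i, zmod_morphism (f i)) -> zmod_morphism (dsum_induced f).
Proof.
move=> fB u v; rewrite /dsum_induced -fsumB; try exact: dsum_induced_fin.
by apply: eq_fsbigr => i _; rewrite dsumBE fB.
Qed.


Lemma dsum_sumE (J : choiceType) (A : set J) (F : J -> dsum) i : finsupp F ->
  (\sum_(j \in A) F j) i = \sum_(j \in A) F j i.
Proof. by move=> fF; apply: (fsum_morph (h := fun u : dsum => u i)). Qed.

Lemma dsum_injs_fin (u : dsum) : finsupp (fun i => dsum_inj i (u i)).
Proof.
have /finsuppP[r _ rf] := dsum_fin u; apply: (@finsuppS _ r) => i /rf ->.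
by rewrite -(subrr 0) dsum_injB subrr.
Qed.

Lemma dsum_injs (u : dsum) : u = \sum_(i \in [set: I]) dsum_inj i (u i).
Proof.
apply: dsumP => j; rewrite (dsum_sumE _ _ (dsum_injs_fin u)).
rewrite (@fsum1 _ _ j) ?dsum_inj_in // => i ij.
by rewrite dsum_inj_out // eq_sym.
Qed.

Lemma dsum_inducedE (W : zmodType) (f : forall i, V i -> W) i (x : V i) :
  (forall i, zmod_morphism (f i)) -> dsum_induced f (dsum_inj i x) = f i x.
Proof.
move=> fB; rewrite /dsum_induced (@fsum1 _ _ i) ?dsum_inj_in // => j ji.
by rewrite dsum_inj_out // -(subrr 0) fB subrr.
Qed.

End DirectSum.
Arguments dsum_inj {I V} i x.

Section GradingIntro.
Variables (G V : zmodType) (X : G -> set V) (p : V -> G -> V).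
Hypothesis pP : forall x,
  [/\ finsupp (p x), forall g, X g (p x g) & x = \sum_(g \in [set: G]) p x g].
Hypothesis p_uniq : forall x f, finsupp f -> (forall g, X g (f g)) ->
  x = \sum_(g \in [set: G]) f g -> forall g, p x g = f g.

Lemma grading_intro x : exists! f : G -> V,
  [/\ finsupp f, forall g, X g (f g) & x = \sum_(g \in [set: G]) f g].
Proof.
exists (p x); split=> [|f [ff Xf xE]]; first exact: pP.
by apply/funext => g; exact: p_uniq.
Qed.

End GradingIntro.

Section DirectSumGrading.
Variables (G : zmodType) (V : G -> zmodType).

Lemma range_dsum_inj g (u : dsum V) :
  range (dsum_inj g) u <-> forall h, h != g -> u h = 0.
Proof.
split=> [[x _ <-] h hg|u0]; first exact: dsum_inj_out.
exists (u g) => //; apply: dsumP => h.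
by have [->|hg] := eqVneq h g; rewrite ?dsum_inj_in ?dsum_inj_out // u0.
Qed.

Lemma dsum_gr0 g : range (@dsum_inj G V g) 0.
Proof. by apply/range_dsum_inj. Qed.

Lemma dsum_grB g (u v : dsum V) : range (dsum_inj g) u ->
  range (dsum_inj g) v -> range (dsum_inj g) (u - v).
Proof.
move=> /range_dsum_inj u0 /range_dsum_inj v0; apply/range_dsum_inj => h hg.
by rewrite dsumBE u0 // v0 // subrr.
Qed.

Lemma dsum_gr_direct (u : dsum V) : exists! f : G -> dsum V,
  [/\ finsupp f, forall g, range (dsum_inj g) (f g) &
      u = \sum_(g \in [set: G]) f g].
Proof.
apply: (@grading_intro G (dsum V) (fun g => range (dsum_inj g))
  (fun u g => dsum_inj g (u g))) => {u} u.
  by split; [exact: dsum_injs_fin|move=> g; exists (u g)|exact: dsum_injs].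
move=> f ff Xf uE g; have fE h k : h != k -> f h k = 0.
  by move=> hk; have /range_dsum_inj := Xf h; apply; rewrite eq_sym.
apply: dsumP => k; have [->|kg] := eqVneq k g.
  by rewrite dsum_inj_in uE (dsum_sumE _ _ ff) (@fsum1 _ _ g) // => i /fE.
by rewrite dsum_inj_out // fE // eq_sym.
Qed.

Definition dsum_grading : grading G (dsum V) :=
  Grading dsum_gr0 dsum_grB dsum_gr_direct.

End DirectSumGrading.

Section DirectSumModule.
Variables (G : zmodType) (R : gradedRing G).
Variables (I : choiceType) (N : I -> gradedModule R).

Definition dsum_gmod_sort := dsum (fun i => N i : zmodType).
HB.instance Definition _ := GRing.Zmodule.on dsum_gmod_sort.
Implicit Types u v : dsum_gmod_sort.

Lemma dsum_scale_fin (a : R) u : finsupp (fun i => a *: u i).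
Proof.
have /finsuppP[r _ rf] := dsum_fin u.
by apply: (@finsuppS _ r) => i /rf ->; rewrite scaler0.
Qed.

Definition dsum_scale (a : R) u : dsum_gmod_sort := Dsum (@dsum_scale_fin a u).

Lemma dsum_scaleA a b u : dsum_scale a (dsum_scale b u) = dsum_scale (a * b) u.
Proof. by apply: dsumP => i /=; rewrite scalerA. Qed.
Lemma dsum_scale1 : left_id 1 dsum_scale.
Proof. by move=> u; apply: dsumP => i /=; rewrite scale1r. Qed.
Lemma dsum_scaleDr : right_distributive dsum_scale +%R.
Proof. by move=> a u v; apply: dsumP => i /=; rewrite scalerDr. Qed.
Lemma dsum_scaleDl v : {morph dsum_scale^~ v : a b / a + b}.
Proof. by move=> a b; apply: dsumP => i /=; rewrite scalerDl. Qed.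

HB.instance Definition _ := GRing.Zmodule_isLmodule.Build R dsum_gmod_sort
  dsum_scaleA dsum_scale1 dsum_scaleDr dsum_scaleDl.

Definition dsum_gmod_comp (g : G) : set dsum_gmod_sort :=
  [set u | forall i, gmod_gr (N i) g (u i)].

Lemma dsum_gmod0 g : dsum_gmod_comp g 0.
Proof. by move=> i; exact: gr0. Qed.

Lemma dsum_gmodB g u v :
  dsum_gmod_comp g u -> dsum_gmod_comp g v -> dsum_gmod_comp g (u - v).
Proof. by move=> gu gv i; apply: grB. Qed.

Lemma dsum_gmod_proj_fin g u : finsupp (fun i => gproj (gmod_gr (N i)) g (u i)).
Proof.
have /finsuppP[r _ rf] := dsum_fin u.
by apply: (@finsuppS _ r) => i /rf ->; rewrite gproj0.
Qed.

Definition dsum_gmod_proj u g : dsum_gmod_sort :=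
  Dsum (@dsum_gmod_proj_fin g u).

Lemma dsum_gmod_direct u : exists! f : G -> dsum_gmod_sort,
  [/\ finsupp f, forall g, dsum_gmod_comp g (f g) &
      u = \sum_(g \in [set: G]) f g].
Proof.
apply: (@grading_intro G dsum_gmod_sort dsum_gmod_comp dsum_gmod_proj) => {u} u.
  have fp : finsupp (dsum_gmod_proj u).
    have /finsuppP[r _ rf] := dsum_fin u.
    pose s i := sval (cid2 ((finsuppP _).1 (gproj_fin (gmod_gr (N i)) (u i)))).
    have sP i g : g \notin s i -> gproj (gmod_gr (N i)) g (u i) = 0.
      by rewrite /s; case: cid2 => /= t _ tf /tf.
    apply: (@finsuppS _ (flatten (map s r))) => g gs; apply: dsumP => i /=.
    have [ir|/rf ->] := boolP (i \in r); last exact: gproj0.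
    apply: sP; apply: contra gs => gsi; apply/flatten_mapP.
    by exists i.
  split=> // [g i|]; first exact: gproj_gr.
  by apply: dsumP => i; rewrite (dsum_sumE _ _ fp) /= gproj_sum.
move=> f ff Xf uE g; apply: dsumP => i /=.
apply: (@gproj_uniq _ _ _ _ (fun g => f g i)) => [|h|]; last 2 first.
- exact: Xf.
- by rewrite [in LHS]uE (dsum_sumE _ _ ff).
have /finsuppP[r _ rf] := ff.
by apply: (@finsuppS _ r) => h /rf ->.
Qed.

Definition dsum_gmod_gr : grading G dsum_gmod_sort :=
  Grading dsum_gmod0 dsum_gmodB dsum_gmod_direct.

Lemma dsum_gmod_scale g h (r : R) u :
  gring_gr R g r -> dsum_gmod_gr h u -> dsum_gmod_gr (g + h) (r *: u).
Proof. by move=> Rr Xu i; apply: gmod_scale. Qed.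

Definition dsum_gmod : gradedModule R := GradedModule dsum_gmod_scale.

Lemma dsum_gmod_inj_linear i :
  linear (dsum_inj i : N i -> dsum_gmod).
Proof.
move=> a x y; apply: dsumP => j; rewrite dsumDE /=.
by case: dfwithP => [|k ik]; rewrite ?dfwithin // !dfwithout // scaler0 addr0.
Qed.

Lemma dsum_gmod_inj_gr i g (x : N i) : gmod_gr (N i) g x ->
  gmod_gr dsum_gmod g (dsum_inj i x).
Proof.
by move=> Nx j /=; case: dfwithP => // k ik; exact: gr0.
Qed.

Definition dsum_gmod_inj i : grHom (N i) dsum_gmod :=
  GrHom (@dsum_gmod_inj_linear i) (@dsum_gmod_inj_gr i).

End DirectSumModule.

Section Small.
Variables (G : zmodType) (R : gradedRing G) (M : gradedModule R).
Implicit Types I : choiceType.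

(* The group homomorphism from the direct sum of the Hom(M, N_i) to
   Hom(M, direct sum of the N_i) induced by the injections of the N_i. *)
Definition small_map (I : choiceType) (N : I -> gradedModule R) :
    dsum (fun i => grHom M (N i)) -> grHom M (dsum_gmod N) :=
  dsum_induced (fun i => grHom_comp (dsum_gmod_inj N i)).

Lemma small_map_componentB I (N : I -> gradedModule R) i :
  zmod_morphism (grHom_comp (dsum_gmod_inj N i) : grHom M (N i) -> _).
Proof. by move=> u v; apply: grHomP => x; exact: grHomB. Qed.

Lemma small_mapB I (N : I -> gradedModule R) : zmod_morphism (@small_map I N).
Proof. exact: (dsum_inducedB (@small_map_componentB I N)). Qed.

Lemma small_mapE I (N : I -> gradedModule R) u x i :
  (@small_map I N u x : dsum_gmod_sort N) i = u i x.
Proof.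
have fu := dsum_induced_fin u (@small_map_componentB I N).
have hB : zmod_morphism (fun v : grHom M (dsum_gmod N) =>
  (v x : dsum_gmod_sort N) i) by [].
rewrite (fsum_morph _ hB fu) (@fsum1 _ _ i) => [|j ji] /=.
  by rewrite dfwithin.
by rewrite dfwithout.
Qed.

Lemma small_map_inj I (N : I -> gradedModule R) : injective (@small_map I N).
Proof.
move=> u v uv; apply: dsumP => i; apply: grHomP => x.
by rewrite -!small_mapE uv.
Qed.

(* Classically every type carries a choiceType structure, so I ranges over all
   types. *)
Definition small : Prop :=
  forall (I : choiceType) (N : I -> gradedModule R), bijective (@small_map I N).

End Small.

Section Shift.
Variables (G : zmodType) (R : gradedRing G) (N : gradedModule R) (g : G).

Definition shift_comp (a : G) : set N := gmod_gr N (a + g).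

Lemma shift_direct (x : N) : exists! f : G -> N,
  [/\ finsupp f, forall a, shift_comp a (f a) & x = \sum_(a \in [set: G]) f a].
Proof.
have sumE (f : G -> N) h :
    \sum_(a \in [set: G]) f a = \sum_(a \in [set: G]) f (a + h).
  by apply: reindex_fsbigT; exists (fun a => a - h) => a; rewrite ?addrK ?subrK.
apply: (@grading_intro G N shift_comp
  (fun x a => gproj (gmod_gr N) (a + g) x)) => {x} x.
  split=> [|a|]; last 2 first.
  - exact: gproj_gr.
  - by rewrite -(sumE (fun a => gproj (gmod_gr N) a x)) gproj_sum.
  exact: (finsupp_comp (addIr g) (gproj_fin _ _)).
move=> f ff Xf xE a; pose f' b := f (b - g).
rewrite (@gproj_uniq _ _ _ _ f') /f' ?addrK // => [|b|].
- exact: (finsupp_comp (addIr (- g)) ff).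
- by have := Xf (b - g); rewrite /shift_comp subrK.
- by rewrite -sumE.
Qed.

Definition shift_gr : grading G N :=
  Grading (fun a => gr0 (gmod_gr N) (a + g))
    (fun a => @grB _ _ (gmod_gr N) (a + g)) shift_direct.

Lemma shift_scale a b (r : R) (x : N) :
  gring_gr R a r -> shift_gr b x -> shift_gr (a + b) (r *: x).
Proof. by move=> Rr Nx; rewrite /= /shift_comp -addrA; exact: gmod_scale. Qed.

Definition shift : gradedModule R := GradedModule shift_scale.

End Shift.

(* An element u of the graded Hom module is a finitely supported family of
   homomorphisms u g : M -> N(g), and r in R of degree a maps a family
   concentrated in degree g to one concentrated in degree a + g. The module
   axioms are checked through the injective map sending u to the sum of the u g,
   as maps from M to N. *)
Section GradedHomModule.
Variables (G : zmodType) (R : gradedRing G) (M N : gradedModule R).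

Definition ghom_sort := dsum (fun g => grHom M (shift N g)).
HB.instance Definition _ := GRing.Zmodule.on ghom_sort.
Implicit Types (u v : ghom_sort) (r s : R) (x : M).

Definition ghom_eval u x : N := \sum_(g \in [set: G]) (u g x : N).

Lemma ghom_eval_fin u x : finsupp (fun g => u g x : N).
Proof.
by have /finsuppP[r _ rf] := dsum_fin u; apply: (@finsuppS _ r) => g /rf ->.
Qed.

Lemma ghom_evalB u v x : ghom_eval (u - v) x = ghom_eval u x - ghom_eval v x.
Proof. by rewrite /ghom_eval -fsumB //; exact: ghom_eval_fin. Qed.

Lemma ghom_evalD u v x : ghom_eval (u + v) x = ghom_eval u x + ghom_eval v x.
Proof. by rewrite /ghom_eval -fsumD //; exact: ghom_eval_fin. Qed.

Lemma ghom_eval_eq0 u : (forall x, ghom_eval u x = 0) -> u = 0.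
Proof.
move=> u0; apply: dsumP => g; apply: grHomP; apply: (gr_ind (X := gmod_gr M)).
- by rewrite !grHom0.
- by move=> x y; rewrite !grHomD => -> ->.
move=> h x Mx; have := congr1 (gproj (gmod_gr N) (h + g)) (u0 x).
rewrite gproj0 (fsum_morph _ (@gprojB _ _ _ _) (ghom_eval_fin u x)).
have uN k : gmod_gr N (h + k) (u k x) by exact: (grHom_gr (u k) Mx).
rewrite (@fsum1 _ _ g) => [|k kg]; rewrite (gproj_hom _ (uN _)) ?eqxx //.
by rewrite (inj_eq (addrI h)) eq_sym (negbTE kg).
Qed.

Lemma ghom_evalP u v : ghom_eval u =1 ghom_eval v -> u = v.
Proof.
move=> uv; apply/eqP; rewrite -subr_eq0; apply/eqP; apply: ghom_eval_eq0 => x.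
by rewrite ghom_evalB uv subrr.
Qed.

Definition ghom_scale_fun r u (k : G) x : N :=
  \sum_(a \in [set: G]) (gproj (gring_gr R) a r *: (u (k - a) x : N)).

Lemma ghom_scale_fun_fin r (f : G -> N) :
  finsupp (fun a => gproj (gring_gr R) a r *: f a).
Proof.
have /finsuppP[s _ sf] := gproj_fin (gring_gr R) r.
by apply: (@finsuppS _ s) => a /sf ->; rewrite scale0r.
Qed.

Lemma ghom_scale_linear r u k :
  linear (ghom_scale_fun r u k : M -> shift N k).
Proof.
move=> c x y; pose F z a : N := gproj (gring_gr R) a r *: (u (k - a) z : N).
have cB : zmod_morphism (fun z : N => c *: z) by move=> ? ?; exact: scalerBr.
have Fx := ghom_scale_fun_fin r (fun a => u (k - a) x).
have Fy := ghom_scale_fun_fin r (fun a => u (k - a) y).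
have cFx : finsupp (fun a => c *: F x a).
  have /finsuppP[s _ sf] := Fx.
  by apply: (@finsuppS _ s) => a /sf Fa; rewrite /F Fa scaler0.
have -> : c *: (ghom_scale_fun r u k x : shift N k) + ghom_scale_fun r u k y =
    \sum_(a \in [set: G]) (c *: F x a + F y a).
  by rewrite fsumD //; congr (_ + _); exact: (fsum_morph _ cB Fx).
apply: eq_fsbigr => a _; rewrite /F grHomD grHomZ [LHS]scalerDr.
by congr (_ + _); rewrite ![LHS]scalerA mulrC -scalerA.
Qed.

Lemma ghom_scale_gr r u k g x : gmod_gr M g x ->
  gmod_gr (shift N k) g (ghom_scale_fun r u k x).
Proof.
move=> Mx; apply: gr_sum => a _.
have /= := gmod_scale (gproj_gr (gring_gr R) a r) (grHom_gr (u (k - a)) Mx).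
by rewrite /shift_comp [a + g]addrC -addrA [a + _]addrC subrK.
Qed.

Definition ghom_scale_comp r u k : grHom M (shift N k) :=
  GrHom (@ghom_scale_linear r u k) (@ghom_scale_gr r u k).

Lemma ghom_scale_supp r u (s t : seq G) :
    (forall a, a \notin s -> gproj (gring_gr R) a r = 0) ->
    (forall a, a \notin t -> u a = 0) ->
  forall k a x, (k \notin [seq b + c | b <- s, c <- t]) || (a \notin s) ->
  gproj (gring_gr R) a r *: (u (k - a) x : N) = 0.
Proof.
move=> sf tf k a x; case: (boolP (a \in s)) => [as_|/sf -> _]; last first.
  by rewrite scale0r.
rewrite orbF => kst; rewrite tf ?scaler0 //; apply: contra kst => kt.
by apply/allpairsP; exists (a, k - a); split=> //=; rewrite addrC subrK.
Qed.

Lemma ghom_scale_fin r u : finsupp (ghom_scale_comp r u).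
Proof.
have /finsuppP[s _ sf] := gproj_fin (gring_gr R) r.
have /finsuppP[t _ tf] := dsum_fin u.
apply: (@finsuppS _ [seq b + c | b <- s, c <- t]) => k kst.
apply: grHomP => x /=; apply: fsbig1 => a _.
by apply: (ghom_scale_supp sf tf); rewrite kst.
Qed.

Definition ghom_scale r u : ghom_sort := Dsum (@ghom_scale_fin r u).

Lemma ghom_evalZ r u x : ghom_eval (ghom_scale r u) x = r *: ghom_eval u x.
Proof.
have /finsuppP[s us sf] := gproj_fin (gring_gr R) r.
have /finsuppP[t _ tf] := dsum_fin u.
rewrite /ghom_eval /= /ghom_scale_fun.
rewrite (fsum_exchange (fun k a => ghom_scale_supp sf tf x)).
rewrite -[r in RHS](gproj_sum (gring_gr R)).
rewrite (fsum_morph _ (h := fun q : R => q *: ghom_eval u x)); first last.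
- exact: gproj_fin.
- by move=> ? ?; exact: scalerBl.
apply: eq_fsbigr => a _.
rewrite -(fsum_morph _ (h := fun z : N => gproj (gring_gr R) a r *: z)).
- congr (_ *: _); apply/esym.
  apply: (@reindex_fsbigT _ _ _ _ _ (fun k => k - a)).
  by exists (fun k => k + a) => k; rewrite ?addrK ?subrK.
- by move=> ? ?; exact: scalerBr.
- exact: (finsupp_comp (addIr (- a)) (ghom_eval_fin u x)).
Qed.

Lemma ghom_scaleA r s u : ghom_scale r (ghom_scale s u) = ghom_scale (r * s) u.
Proof. by apply: ghom_evalP => x; rewrite !ghom_evalZ scalerA. Qed.
Lemma ghom_scale1 : left_id 1 ghom_scale.
Proof. by move=> u; apply: ghom_evalP => x; rewrite ghom_evalZ scale1r. Qed.
Lemma ghom_scaleDr : right_distributive ghom_scale +%R.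
Proof.
move=> r u v; apply: ghom_evalP => x.
by rewrite ghom_evalZ !ghom_evalD scalerDr !ghom_evalZ.
Qed.
Lemma ghom_scaleDl v : {morph ghom_scale^~ v : r s / r + s}.
Proof.
move=> r s; apply: ghom_evalP => x.
by rewrite ghom_evalZ ghom_evalD scalerDl !ghom_evalZ.
Qed.

HB.instance Definition _ := GRing.Zmodule_isLmodule.Build R ghom_sort
  ghom_scaleA ghom_scale1 ghom_scaleDr ghom_scaleDl.

Definition ghom_gr : grading G ghom_sort :=
  dsum_grading (fun g => grHom M (shift N g)).

Lemma ghom_gmod_scale g h r u :
  gring_gr R g r -> ghom_gr h u -> ghom_gr (g + h) (r *: u).
Proof.
move=> Rr /range_dsum_inj u0; apply/range_dsum_inj => k kgh.
apply: grHomP => x; apply: fsbig1 => a _; rewrite (gproj_hom _ Rr).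
case: eqP => [->|_]; last by rewrite scale0r.
by rewrite u0 ?scaler0 // subr_eq addrC.
Qed.

Definition ghom : gradedModule R := GradedModule ghom_gmod_scale.

End GradedHomModule.

Section CoarsenGrading.
Variables (G H : zmodType) (psi : {additive G -> H}).
Variables (V : zmodType) (X : grading G V).
Implicit Types (x y : V) (g : G) (h : H).

(* The sum of the subgroups X g for g in the fiber of psi over h. *)
Definition coarsen_comp h : set V :=
  [set x | exists f : G -> V, [/\ finsupp f, forall g, psi g = h -> X g (f g) &
     x = \sum_(g \in psi @^-1` [set h]) f g]].

Lemma coarsen_comp_sum h (I : choiceType) (A : set I) (f : I -> V) :
  (forall i, A i -> exists2 g, psi g = h & X g (f i)) ->
  coarsen_comp h (\sum_(i \in A) f i).
Proof.
move=> Xf; apply: fsum_ind => [|x y|i Ai].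
- exists (fun=> 0); split=> [|g _|]; last by rewrite fsbig1.
    exact: (@finsuppS _ [::]).
  exact: gr0.
- move=> [f1 [/finsuppP[r1 u1 h1] X1 ->]] [f2 [/finsuppP[r2 u2 h2] X2 ->]].
  have ff1 : finsupp f1 by exact: finsuppS h1.
  have ff2 : finsupp f2 by exact: finsuppS h2.
  exists (fun g => f1 g + f2 g); split=> [|g gh|]; last by rewrite fsumD.
    apply: (@finsuppS _ (r1 ++ r2)) => g; rewrite mem_cat negb_or.
    by move=> /andP[/h1 -> /h2 ->]; rewrite addr0.
  by apply: grD; [exact: X1|exact: X2].
- have [g gh Xg] := Xf i Ai; exists (fun k => if k == g then f i else 0); split.
  + by apply: (@finsuppS _ [:: g]) => k; rewrite inE => /negbTE ->.
  + by move=> k _; case: eqP => [->//|_]; exact: gr0.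
  rewrite (@fsumE _ _ _ [:: g]) //; last by move=> k; rewrite inE => /negbTE ->.
  by rewrite big_mkcond big_seq1 eqxx mem_set.
Qed.

Lemma coarsen_comp_hom g x : X g x -> coarsen_comp (psi g) x.
Proof.
move=> Xx; have -> : x = \sum_(i \in [set: unit]) x.
  by rewrite (@fsum1 _ _ tt) => [|[]].
by apply: coarsen_comp_sum => _ _; exists g.
Qed.

Lemma coarsen_ind h (P : V -> Prop) :
  P 0 -> (forall x y, P x -> P y -> P (x + y)) ->
  (forall g x, psi g = h -> X g x -> P x) -> forall x, coarsen_comp h x -> P x.
Proof.
move=> P0 PD PX x [f [_ Xf ->]]; apply: fsum_ind => // g gh.
exact: PX gh (Xf _ gh).
Qed.

Lemma coarsen_compP h x :
  coarsen_comp h x <-> forall g, psi g <> h -> gproj X g x = 0.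
Proof.
split=> [|x0].
  apply: (@coarsen_ind h (fun x => forall g, psi g <> h -> gproj X g x = 0))
    => [g _|y z y0 z0 g gh|k y kh Xy g gh]; first exact: gproj0.
    by rewrite gprojD y0 // z0 // addr0.
  by rewrite (gproj_hom _ Xy); case: eqP => // gk; case: gh; rewrite gk.
have -> : x = \sum_(g \in psi @^-1` [set h]) gproj X g x.
  rewrite -[LHS](gproj_sum X); apply/esym; apply: fsbig_widen => // g [_].
  exact: x0.
by apply: coarsen_comp_sum => g gh; exists g => //; exact: gproj_gr.
Qed.

Lemma coarsen_comp0 h : coarsen_comp h 0.
Proof. by apply/coarsen_compP => g _; exact: gproj0. Qed.

Lemma coarsen_compB h x y :
  coarsen_comp h x -> coarsen_comp h y -> coarsen_comp h (x - y).
Proof.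
move=> /coarsen_compP x0 /coarsen_compP y0; apply/coarsen_compP => g gh.
by rewrite gprojB x0 // y0 // subrr.
Qed.

Lemma coarsen_compD h x y :
  coarsen_comp h x -> coarsen_comp h y -> coarsen_comp h (x + y).
Proof.
move=> /coarsen_compP x0 /coarsen_compP y0; apply/coarsen_compP => g gh.
by rewrite gprojD x0 // y0 // addr0.
Qed.

Lemma coarsen_direct x : exists! f : H -> V,
  [/\ finsupp f, forall h, coarsen_comp h (f h) &
      x = \sum_(h \in [set: H]) f h].
Proof.
apply: (@grading_intro H V coarsen_comp
  (fun x h => \sum_(g \in psi @^-1` [set h]) gproj X g x)) => {x} x.
  have [ff fE] := fsum_fibers psi (gproj_fin X x); split=> // [h|].
    by apply: coarsen_comp_sum => g gh; exists g => //; exact: gproj_gr.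
  by rewrite fE gproj_sum.
move=> f ff Xf xE h; have /coarsen_compP fh := Xf h.
rewrite -[RHS](gproj_sum X).
rewrite -[RHS](@fsbig_widen _ _ _ _ (psi @^-1` [set h])) //; last first.
  by move=> g [_ gh]; apply: fh.
apply: eq_fsbigr => g /set_mem gh.
rewrite xE (fsum_morph _ (gprojB X g) ff) (@fsum1 _ _ h) // => k kh.
by have /coarsen_compP := Xf k; apply; rewrite gh => hk; rewrite hk eqxx in kh.
Qed.

Definition coarsen_gr : grading H V :=
  Grading coarsen_comp0 coarsen_compB coarsen_direct.

End CoarsenGrading.

Section CoarsenModule.
Variables (G H : zmodType) (psi : {additive G -> H}) (R : gradedRing G).

Lemma coarsen_ring_mul h k (r s : R) : coarsen_gr psi (gring_gr R) h r ->
  coarsen_gr psi (gring_gr R) k s ->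
  coarsen_gr psi (gring_gr R) (h + k) (r * s).
Proof.
pose Q := coarsen_comp psi (gring_gr R) (h + k).
move=> Rr; apply: (@coarsen_ind _ _ _ _ _ k (fun s => Q (r * s)))
  => [|s1 s2 ? ?|b t bk Rt].
- by rewrite mulr0; exact: coarsen_comp0.
- by rewrite mulrDr; exact: coarsen_compD.
move: r Rr; apply: (@coarsen_ind _ _ _ _ _ h (fun r => Q (r * t)))
  => [|r1 r2 ? ?|a r ah Rr].
- by rewrite mul0r; exact: coarsen_comp0.
- by rewrite mulrDl; exact: coarsen_compD.
by rewrite /Q -ah -bk -raddfD; apply: coarsen_comp_hom; exact: gring_mul.
Qed.

Definition coarsen_ring : gradedRing H := GradedRing coarsen_ring_mul.

Lemma coarsen_gmod_scale (M : gradedModule R) h k (r : coarsen_ring) (x : M) :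
  gring_gr coarsen_ring h r -> coarsen_gr psi (gmod_gr M) k x ->
  coarsen_gr psi (gmod_gr M) (h + k) ((r : R) *: x).
Proof.
pose Q := coarsen_comp psi (gmod_gr M) (h + k).
move=> Rr; apply: (@coarsen_ind _ _ _ _ _ k (fun x => Q ((r : R) *: x)))
  => [|x1 x2 ? ?|b t bk Rt].
- by rewrite scaler0; exact: coarsen_comp0.
- by rewrite scalerDr; exact: coarsen_compD.
move: r Rr; apply: (@coarsen_ind _ _ _ _ _ h (fun r : R => Q (r *: t)))
  => [|r1 r2 ? ?|a r ah Rr].
- by rewrite scale0r; exact: coarsen_comp0.
- by rewrite scalerDl; exact: coarsen_compD.
by rewrite /Q -ah -bk -raddfD; apply: coarsen_comp_hom; exact: gmod_scale.
Qed.

Definition coarsen_gmod (M : gradedModule R) : gradedModule coarsen_ring :=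
  @GradedModule H coarsen_ring M _ (@coarsen_gmod_scale M).

Lemma coarsen_hom_shift_gr (M N : gradedModule R) g (u : grHom M (shift N g)) h
    (x : M) : gmod_gr (coarsen_gmod M) h x ->
  gmod_gr (shift (coarsen_gmod N) (psi g)) h (u x).
Proof.
apply: (@coarsen_ind _ _ _ _ _ h
  (fun x => gmod_gr (shift (coarsen_gmod N) (psi g)) h (u x)))
  => [|y z Ny Nz|a y <- My].
- by rewrite grHom0; exact: gr0.
- by rewrite grHomD; exact: grD.
rewrite /= /shift_comp -raddfD; apply: coarsen_comp_hom.
exact: (grHom_gr u My).
Qed.

(* The coarsening of M -> N(g), as a morphism to the shift by psi g of the
   coarsening of N. *)
Definition coarsen_hom_shift (M N : gradedModule R) g
    (u : grHom M (shift N g)) :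
    grHom (coarsen_gmod M) (shift (coarsen_gmod N) (psi g)) :=
  @GrHom H coarsen_ring (coarsen_gmod M) (shift (coarsen_gmod N) (psi g)) u
    (grHom_linear u) (@coarsen_hom_shift_gr M N g u).

Lemma coarsen_hom_gr (M N : gradedModule R) (u : grHom M N) h (x : M) :
  gmod_gr (coarsen_gmod M) h x -> gmod_gr (coarsen_gmod N) h (u x).
Proof.
apply: (@coarsen_ind _ _ _ _ _ h (fun x => gmod_gr (coarsen_gmod N) h (u x)))
  => [|y z Ny Nz|a y <- My].
- by rewrite grHom0; exact: gr0.
- by rewrite grHomD; exact: grD.
by apply: coarsen_comp_hom; exact: (grHom_gr u My).
Qed.

Definition coarsen_hom (M N : gradedModule R) (u : grHom M N) :
    grHom (coarsen_gmod M) (coarsen_gmod N) :=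
  @GrHom H coarsen_ring (coarsen_gmod M) (coarsen_gmod N) u (grHom_linear u)
    (@coarsen_hom_gr M N u).

End CoarsenModule.

Section CanonicalMorphism.
Variables (G H : zmodType) (psi : {additive G -> H}) (R : gradedRing G).
Variables (M N : gradedModule R).

Local Notation U := (coarsen_gmod psi (ghom M N)).
Local Notation W := (ghom (coarsen_gmod psi M) (coarsen_gmod psi N)).

(* Induced on the direct sum by u |-> u_[psi] : M_[psi] -> N_[psi](psi g) for
   each g, followed by the injection of the component of degree psi g. *)
Definition hpsi_fun : U -> W :=
  dsum_induced (fun g (u : grHom M (shift N g)) =>
    dsum_inj (psi g) (coarsen_hom_shift psi u)).

Lemma hpsi_componentB g : zmod_morphism (fun u : grHom M (shift N g) =>
  dsum_inj (psi g) (coarsen_hom_shift psi u) : W).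
Proof.
move=> u v; rewrite -[RHS]dsum_injB; congr (dsum_inj _ _).
exact: grHomP.
Qed.

Lemma hpsi_funB : zmod_morphism hpsi_fun.
Proof. exact: (dsum_inducedB hpsi_componentB). Qed.

Lemma hpsi_eval (u : U) x : ghom_eval (hpsi_fun u) x = ghom_eval u x.
Proof.
rewrite /hpsi_fun /dsum_induced.
rewrite (fsum_morph (h := fun w : W => ghom_eval w x)).
- apply: eq_fsbigr => g _; rewrite /ghom_eval (@fsum1 _ _ (psi g)) => [|k kg].
    by rewrite dsum_inj_in.
  by rewrite dsum_inj_out.
- by move=> v w; exact: ghom_evalB.
- exact: (dsum_induced_fin _ hpsi_componentB).
Qed.

Lemma hpsi_linear : linear hpsi_fun.
Proof.
move=> r u v; apply: ghom_evalP => x.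
rewrite hpsi_eval [in RHS]ghom_evalD [X in _ = X + _]ghom_evalZ !hpsi_eval.
by rewrite [LHS]ghom_evalD; congr (_ + _); exact: (@ghom_evalZ G R M N r u x).
Qed.

Lemma hpsi_gr h (u : U) : gmod_gr U h u -> gmod_gr W h (hpsi_fun u).
Proof.
have hD u1 u2 : hpsi_fun (u1 + u2) = hpsi_fun u1 + hpsi_fun u2.
  by have := hpsi_linear 1 u1 u2; rewrite !scale1r.
apply: (@coarsen_ind _ _ _ _ _ h (fun u => gmod_gr W h (hpsi_fun u)))
  => [|u1 u2|g u1 <- [u0 _ <-]].
- have -> : hpsi_fun 0 = 0 by rewrite -[in LHS](subrr 0) hpsi_funB subrr.
  exact: gr0.
- by rewrite hD; exact: grD.
exists (coarsen_hom_shift psi u0) => //.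
by rewrite /hpsi_fun (dsum_inducedE _ hpsi_componentB).
Qed.

Lemma hpsi_inj : injective hpsi_fun.
Proof.
move=> u v uv; apply: ghom_evalP => x.
by rewrite -(hpsi_eval u) -(hpsi_eval v) uv.
Qed.

Definition hpsi_hom : grHom U W := GrHom hpsi_linear hpsi_gr.

End CanonicalMorphism.

Record grFunctor (G H : zmodType) (R : gradedRing G) (S : gradedRing H) :=
  GrFunctor {
    fobj :> gradedModule R -> gradedModule S;
    fmap : forall M N, grHom M N -> grHom (fobj M) (fobj N);
    fmap_id : forall M, fmap (grHom_id M) = grHom_id (fobj M);
    fmap_comp : forall M N P (v : grHom N P) (u : grHom M N),
      fmap (grHom_comp v u) = grHom_comp (fmap v) (fmap u) }.

Definition grFunctor_comp (G H K : zmodType) (R : gradedRing G)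
    (S : gradedRing H) (T : gradedRing K)
    (F' : grFunctor S T) (F : grFunctor R S) : grFunctor R T.
Proof.
exists (fun M => F' (F M)) (fun M N u => fmap F' (fmap F u)) => [M|M N P v u].
- by rewrite !fmap_id.
- by rewrite !fmap_comp.
Defined.

Record grNat (G H : zmodType) (R : gradedRing G) (S : gradedRing H)
    (F F' : grFunctor R S) := GrNat {
  ncomp :> forall N, grHom (F N) (F' N);
  natural : forall N N' (v : grHom N N'),
    grHom_comp (ncomp N') (fmap F v) = grHom_comp (fmap F' v) (ncomp N) }.

Definition grNat_iso (G H : zmodType) (R : gradedRing G) (S : gradedRing H)
    (F F' : grFunctor R S) (eta : grNat F F') : Prop :=
  exists theta : grNat F' F, forall N,
    grHom_comp (theta N) (eta N) = grHom_id (F N) /\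
    grHom_comp (eta N) (theta N) = grHom_id (F' N).

Section Coarsening.
Variables (G H : zmodType) (psi : {additive G -> H}) (R : gradedRing G).

Lemma coarsen_hom_id (M : gradedModule R) :
  coarsen_hom psi (grHom_id M) = grHom_id (coarsen_gmod psi M).
Proof. exact: grHomP. Qed.

Lemma coarsen_hom_comp (M N P : gradedModule R) (v : grHom N P)
    (u : grHom M N) :
  coarsen_hom psi (grHom_comp v u) =
  grHom_comp (coarsen_hom psi v) (coarsen_hom psi u).
Proof. exact: grHomP. Qed.

Definition coarsen : grFunctor R (coarsen_ring psi R) :=
  GrFunctor coarsen_hom_id coarsen_hom_comp.

End Coarsening.

Section GradedHomFunctor.
Variables (G : zmodType) (R : gradedRing G) (M : gradedModule R).

Definition shift_hom (N N' : gradedModule R) (v : grHom N N') g :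
    grHom (shift N g) (shift N' g) :=
  @GrHom G R (shift N g) (shift N' g) v (grHom_linear v)
    (fun a x Nx => grHom_gr v Nx).

Lemma ghom_map_fin (N N' : gradedModule R) (v : grHom N N') (u : ghom M N) :
  finsupp (fun g => grHom_comp (shift_hom v g) (u g)).
Proof.
have /finsuppP[r _ rf] := dsum_fin u; apply: (@finsuppS _ r) => g /rf ->.
by apply: grHomP => x /=; exact: grHom0.
Qed.

Definition ghom_map_fun (N N' : gradedModule R) (v : grHom N N')
  (u : ghom M N) : ghom M N' := Dsum (@ghom_map_fin N N' v u).

Lemma ghom_map_eval (N N' : gradedModule R) (v : grHom N N') (u : ghom M N) x :
  ghom_eval (ghom_map_fun v u) x = v (ghom_eval u x).
Proof. by rewrite [RHS](fsum_morph _ (grHomB v) (ghom_eval_fin u x)). Qed.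

Lemma ghom_map_linear (N N' : gradedModule R) (v : grHom N N') :
  linear (@ghom_map_fun N N' v).
Proof.
move=> r u w; apply: ghom_evalP => x.
rewrite ghom_map_eval [in LHS]ghom_evalD [in RHS]ghom_evalD grHomD.
congr (_ + _); last by rewrite ghom_map_eval.
by rewrite [X in v X]ghom_evalZ [RHS]ghom_evalZ grHomZ ghom_map_eval.
Qed.

Lemma ghom_map_gr (N N' : gradedModule R) (v : grHom N N') g (u : ghom M N) :
  gmod_gr (ghom M N) g u -> gmod_gr (ghom M N') g (ghom_map_fun v u).
Proof.
move=> /range_dsum_inj u0; apply/range_dsum_inj => h hg; apply: grHomP => x /=.
by rewrite u0 //; exact: grHom0.
Qed.

Definition ghom_map (N N' : gradedModule R) (v : grHom N N') :
    grHom (ghom M N) (ghom M N') :=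
  GrHom (@ghom_map_linear N N' v) (@ghom_map_gr N N' v).

Lemma ghom_map_id N : ghom_map (grHom_id N) = grHom_id (ghom M N).
Proof.
by apply: grHomP => u; apply: dsumP => g; apply: grHomP.
Qed.

Lemma ghom_map_comp (N P Q : gradedModule R) (v : grHom P Q) (w : grHom N P) :
  ghom_map (grHom_comp v w) = grHom_comp (ghom_map v) (ghom_map w).
Proof.
by apply: grHomP => u; apply: dsumP => g; apply: grHomP.
Qed.

Definition ghom_functor : grFunctor R R := GrFunctor ghom_map_id ghom_map_comp.

End GradedHomFunctor.

Section CanonicalNat.
Variables (G H : zmodType) (psi : {additive G -> H}) (R : gradedRing G).
Variable M : gradedModule R.

Local Notation F := (grFunctor_comp (coarsen psi R) (ghom_functor M)).
Local Notation F' :=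
  (grFunctor_comp (ghom_functor (coarsen psi R M)) (coarsen psi R)).

Lemma hpsi_natural (N N' : gradedModule R) (v : grHom N N') :
  grHom_comp (hpsi_hom psi M N') (fmap F v) =
  grHom_comp (fmap F' v) (hpsi_hom psi M N).
Proof.
apply: grHomP => u; apply: ghom_evalP => x.
rewrite [LHS]hpsi_eval [LHS]ghom_map_eval.
rewrite [RHS](ghom_map_eval (coarsen_hom psi v) (hpsi_fun u)).
by congr (v _); rewrite hpsi_eval.
Qed.

Definition hpsi : grNat F F' :=
  @GrNat _ _ _ _ F F' (hpsi_hom psi M) hpsi_natural.

End CanonicalNat.

(* Main.v *)
Require Import Defs.
From mathcomp Require Import all_boot all_order all_algebra.
From mathcomp Require Import all_classical.

(* An R-linear map f : M -> N is the pointwise finite sum of its homogeneous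
   components f_g : M -> N(g), where f_g x is the part of f x of degree k + g
   for x in M_k. An element of the H-graded Hom module comes from the G-graded
   one exactly if its underlying map has finitely many nonzero components. The
   family (f_g) is a morphism M -> (+)_g N(g), so if M is small it is finite; if
   Ker(psi) is finite, only finitely many g lie over the finitely many H-degrees
   of f. *)

Set Implicit Arguments.
Unset Strict Implicit.
Unset Printing Implicit Defensive.

Import GRing.Theory.
Local Open Scope classical_set_scope.
Local Open Scope ring_scope.

(** * Isomorphisms of functors as pointwise bijections *)

Lemma inj_surj_bijective (T U : Type) (f : T -> U) :
  injective f -> (forall y, range f y) -> bijective f.
Proof.
move=> fI fS; have fE y : exists x, f x = y by have [x _] := fS y; exists x.
by have [g gK] := choice fE; exists g => // x; apply: fI.
Qed.

Section GradedIso.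
Variables (G : zmodType) (R : gradedRing G).
Implicit Types M N : gradedModule R.

Lemma gproj_grHom M N (u : grHom M N) g x :
  gproj (gmod_gr N) g (u x) = u (gproj (gmod_gr M) g x).
Proof.
move: x; apply: (gr_ind (X := gmod_gr M)) => [|x y IHx IHy|h x Mx].
- by rewrite grHom0 !gproj0 grHom0.
- by rewrite grHomD !gprojD IHx IHy grHomD.
rewrite (gproj_hom _ Mx) (gproj_hom _ (grHom_gr u Mx)).
by case: eqP; rewrite ?grHom0.
Qed.

(** Since u commutes with the projections, it takes the same value at x and at the part of x of
    degree g. This makes the inverse of a bijective morphism degree-preserving. *)
Lemma grHom_reflect_gr M N (u : grHom M N) g x : injective u ->
  gmod_gr N g (u x) -> gmod_gr M g x.
Proof.
move=> uI Nux; rewrite -[x](_ : gproj (gmod_gr M) g x = x).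
  exact: gproj_gr.
by apply: uI; rewrite -gproj_grHom (gproj_hom _ Nux) eqxx.
Qed.

Lemma grHom_inv M N (u : grHom M N) : bijective u ->
  exists v : grHom N M, cancel u v /\ cancel v u.
Proof.
move=> [v uK vK]; have uI := can_inj uK.
have vL : linear v by move=> a x y; apply: uI; rewrite (grHom_linear u) !vK.
have vG g y : gmod_gr N g y -> gmod_gr M g (v y).
  by rewrite -{1}[y]vK; exact: grHom_reflect_gr.
by exists (GrHom vL vG).
Qed.

End GradedIso.

Lemma grNat_isoP (G H : zmodType) (R : gradedRing G) (S : gradedRing H)
    (F F' : grFunctor R S) (eta : grNat F F') :
  grNat_iso eta <-> forall N, bijective (eta N).
Proof.
split=> [[theta etaK] N|eta_bij].
  have [K1 K2] := etaK N.
  exists (theta N) => x; first exact: (congr1 (fun u : grHom _ _ => u x) K1).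
  exact: (congr1 (fun u : grHom _ _ => u x) K2).
pose theta N := sval (cid (grHom_inv (eta_bij N))).
have thetaP N : cancel (eta N) (theta N) /\ cancel (theta N) (eta N).
  exact: svalP (cid (grHom_inv (eta_bij N))).
(* Pointwise inverses are automatically natural: after applying the injective [eta N'], this is
   naturality of [eta] at [theta N x]. *)
have thetaN N N' (v : grHom N N') :
      grHom_comp (theta N') (Defs.fmap F' v) =
      grHom_comp (Defs.fmap F v) (theta N).
  apply: grHomP => x /=; have [K1 K2] := thetaP N; have [K1' K2'] := thetaP N'.
  apply: (can_inj K1'); rewrite K2'.
  have /(congr1 (fun u : grHom _ _ => u (theta N x))) /= := natural eta v.
  by rewrite K2.
exists (GrNat thetaN) => N; have [K1 K2] := thetaP N.
by split; apply: grHomP.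
Qed.

(** * Smallness in terms of coordinates *)

Section SmallCriterion.
Variables (G : zmodType) (R : gradedRing G).

Definition dsum_gmod_coord (I : choiceType) (N : I -> gradedModule R) i :
    grHom (dsum_gmod N) (N i) :=
  @GrHom G R (dsum_gmod N) (N i) (fun x : dsum_gmod_sort N => x i)
    (fun a x y => erefl) (fun g x Nx => Nx i).

(** The coordinates of u are the only candidate for a preimage under [small_map], and they form one
    exactly when finitely many are nonzero. *)
Lemma smallP (M : gradedModule R) : small M <->
  forall (I : choiceType) (N : I -> gradedModule R)
    (u : grHom M (dsum_gmod N)),
  finsupp (fun i => grHom_comp (dsum_gmod_coord N i) u).
Proof.
split=> [sM I N u|sM I N].
  have [f _ fK] := sM I N; have /finsuppP[r _ rf] := dsum_fin (f u).
  apply: (@finsuppS _ r) => i /rf fui; apply: grHomP => x /=.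
  by have := small_mapE (f u) x i; rewrite fK fui.
apply: inj_surj_bijective; first exact: small_map_inj.
move=> u; exists (Dsum (sM I N u)) => //; apply: grHomP => x.
by apply: dsumP => i; rewrite small_mapE.
Qed.

End SmallCriterion.

(** * Homogeneous components of a linear map *)

Section HomComponent.
Variables (G : zmodType) (R : gradedRing G) (M N : gradedModule R).
Variables (f : M -> N).
Hypothesis fL : linear f.

(** The sum over k extends the prescription on homogeneous elements additively to M; it is finite
    because x has finitely many nonzero parts. *)
Definition hom_component_fun g (x : M) : N :=
  \sum_(k \in [set: G]) gproj (gmod_gr N) (k + g) (f (gproj (gmod_gr M) k x)).

Let fD x y : f (x + y) = f x + f y.
Proof. by have := fL 1 x y; rewrite !scale1r. Qed.
Let f0 : f 0 = 0.
Proof. by apply: (addrI (f 0)); rewrite -fD !addr0. Qed.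
Let fZ r x : f (r *: x) = r *: f x.
Proof. by have := fL r x 0; rewrite !addr0 f0 addr0. Qed.

Let hom_component_fin g x : finsupp (fun k =>
  gproj (gmod_gr N) (k + g) (f (gproj (gmod_gr M) k x))).
Proof.
have /finsuppP[r _ rf] := gproj_fin (gmod_gr M) x.
by apply: (@finsuppS _ r) => k /rf ->; rewrite f0 gproj0.
Qed.

Lemma hom_component_hom g k x : gmod_gr M k x ->
  hom_component_fun g x = gproj (gmod_gr N) (k + g) (f x).
Proof.
move=> Mx; rewrite /hom_component_fun (@fsum1 _ _ k) => [|i /negbTE ik].
  by rewrite (gproj_hom _ Mx) eqxx.
by rewrite (gproj_hom _ Mx) ik f0 gproj0.
Qed.

Lemma hom_component_funD g x y :
  hom_component_fun g (x + y) = hom_component_fun g x + hom_component_fun g y.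
Proof.
rewrite /hom_component_fun -fsumD; try exact: hom_component_fin.
by apply: eq_fsbigr => k _; rewrite gprojD fD gprojD.
Qed.

Lemma hom_component_fun0 g : hom_component_fun g 0 = 0.
Proof. by rewrite (hom_component_hom g (gr0 _ 0)) f0 gproj0. Qed.

(** By additivity x, r and then the value f x may be taken homogeneous. For r of degree a, scaling
    by r moves degree k + g to a + k + g, compatibly with the projections. *)
Lemma hom_component_funZ g r x :
  hom_component_fun g (r *: x) = r *: hom_component_fun g x.
Proof.
move: x; apply: (gr_ind (X := gmod_gr M)) => [|x y IHx IHy|k x Mx].
- by rewrite scaler0 hom_component_fun0 scaler0.
- by rewrite scalerDr !hom_component_funD IHx IHy scalerDr.
move: r; apply: (gr_ind (X := gring_gr R)) => [|r s IHr IHs|a r Rr].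
- by rewrite !scale0r hom_component_fun0.
- by rewrite !scalerDl hom_component_funD IHr IHs.
rewrite (hom_component_hom g (gmod_scale Rr Mx)) (hom_component_hom g Mx) fZ.
move: (f x); apply: (gr_ind (X := gmod_gr N)) => [|y z IHy IHz|b y Ny].
- by rewrite !(scaler0, gproj0).
- by rewrite !(scalerDr, gprojD) IHy IHz.
rewrite (gproj_hom _ (gmod_scale Rr Ny)) (gproj_hom _ Ny).
rewrite -addrA (inj_eq (addrI a)).
by case: ifP => _; rewrite ?scaler0.
Qed.

Lemma hom_component_linear g : linear (hom_component_fun g : M -> shift N g).
Proof. by move=> a x y; rewrite hom_component_funD hom_component_funZ. Qed.

Lemma hom_component_gr g k x : gmod_gr M k x ->
  gmod_gr (shift N g) k (hom_component_fun g x).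
Proof. move=> Mx; rewrite (hom_component_hom g Mx); exact: gproj_gr. Qed.

Definition hom_component g : grHom M (shift N g) :=
  GrHom (@hom_component_linear g) (@hom_component_gr g).

(** For x of degree k, the values at x are the homogeneous parts of f x, reindexed by the bijection
    sending g to k + g. The finite support obtained here depends on x. *)
Lemma hom_component_sum x :
  finsupp (fun g => hom_component g x : N) /\
  \sum_(g \in [set: G]) (hom_component g x : N) = f x.
Proof.
move: x; apply: (gr_ind (X := gmod_gr M)) => [|x y [fx sx] [fy sy]|k x Mx].
- split; first by apply: (@finsuppS _ [::]) => g _; exact: hom_component_fun0.
  by rewrite f0 fsbig1 // => g _; exact: hom_component_fun0.
- have E g : (hom_component g (x + y) : N) =
      (hom_component g x : N) + (hom_component g y : N).
    exact: hom_component_funD.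
  split; last by rewrite fD -sx -sy -fsumD //; exact: eq_fsbigr.
  have /finsuppP[r _ rf] := fx; have /finsuppP[s _ sf] := fy.
  apply: (@finsuppS _ (r ++ s)) => g; rewrite mem_cat negb_or E.
  by move=> /andP[/rf -> /sf ->]; rewrite addr0.
have E g : (hom_component g x : N) = gproj (gmod_gr N) (k + g) (f x).
  exact: hom_component_hom.
have EF : (fun g => hom_component g x : N) =
    (fun g => gproj (gmod_gr N) (k + g) (f x)) by apply/funext.
split; first by rewrite EF; exact: (finsupp_comp (addrI k) (gproj_fin _ _)).
rewrite -[RHS](gproj_sum (gmod_gr N)).
transitivity (\sum_(g \in [set: G]) gproj (gmod_gr N) (k + g) (f x)).
  by apply: eq_fsbigr => g _; exact: E.
apply/esym; apply: (@reindex_fsbigT _ _ _ _ _ (fun g => k + g)).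
by exists (fun g => - k + g) => g; rewrite ?addKr ?addNKr.
Qed.

End HomComponent.

(** * Recovering an element of the graded Hom module from its underlying map *)

Section GradedHomEval.
Variables (G : zmodType) (R : gradedRing G) (M N : gradedModule R).

Lemma ghom_eval_linear (u : ghom M N) : linear (ghom_eval u).
Proof.
move=> a x y; rewrite /ghom_eval.
have aB : zmod_morphism (fun z : N => a *: z) by move=> ? ?; exact: scalerBr.
rewrite [X in _ = X + _](fsum_morph _ aB (ghom_eval_fin u x)) -fsumD.
- by apply: eq_fsbigr => g _; exact: (grHom_linear (u g) a x y).
- have /finsuppP[r _ rf] := ghom_eval_fin u x.
  by apply: (@finsuppS _ r) => g /rf ->; rewrite scaler0.
- exact: ghom_eval_fin.
Qed.

(** On M_k the summand [u h] has values in degree k + h, so projecting to degree k + g leaves only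
    [u g]. *)
Lemma hom_component_eval (u : ghom M N) (uL : linear (ghom_eval u)) g :
  hom_component uL g = u g.
Proof.
apply: grHomP; apply: (gr_ind (X := gmod_gr M)) => [|x y IHx IHy|k x Mx].
- by rewrite !grHom0.
- by rewrite !grHomD IHx IHy.
have uN h : gmod_gr N (k + h) (u h x) by exact: (grHom_gr (u h) Mx).
rewrite [LHS](hom_component_hom uL g Mx).
rewrite (fsum_morph _ (@gprojB _ _ _ _) (ghom_eval_fin u x)).
rewrite (@fsum1 _ _ g) => [|h hg]; rewrite (gproj_hom _ (uN _)) ?eqxx //.
by rewrite (inj_eq (addrI k)) eq_sym (negbTE hg).
Qed.

End GradedHomEval.

(** * The image of the canonical morphism *)

Section CanonicalMorphismRange.
Variables (G H : zmodType) (psi : {additive G -> H}) (R : gradedRing G).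
Variables (M N : gradedModule R).

Local Notation W := (ghom (coarsen_gmod psi M) (coarsen_gmod psi N)).

(** [hpsi_fun] preserves underlying maps, and these determine the elements of a graded Hom module.
    So the components of [ghom_eval w] are the only possible preimage of w. *)
Lemma hpsi_rangeP (w : W) (wL : linear (ghom_eval w : M -> N)) :
  range (@hpsi_fun _ _ psi _ M N) w <-> finsupp (hom_component wL).
Proof.
split=> [[u _ uw]|fw].
  have uE : (ghom_eval w : M -> N) = ghom_eval u.
    by apply/funext => x; rewrite -uw hpsi_eval.
  move: wL; rewrite uE => uL; have /finsuppP[r _ rf] := dsum_fin u.
  by apply: (@finsuppS _ r) => g /rf ug; rewrite hom_component_eval.
exists (Dsum fw) => //; apply: ghom_evalP => x.
by rewrite hpsi_eval; exact: (hom_component_sum wL x).2.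
Qed.

(** On M_k the values of [w h] have nonzero parts only in degrees lying over psi k + h, so only h =
    psi g can contribute to degree k + g. *)
Lemma hom_component_coarsen_eq0 (w : W) (wL : linear (ghom_eval w : M -> N)) g :
  w (psi g) = 0 -> hom_component wL g = 0.
Proof.
move=> wg0; apply: grHomP => x.
move: x; apply: (gr_ind (X := gmod_gr M)) => [|x y IHx IHy|k x Mx].
- by rewrite grHom0.
- by rewrite grHomD IHx IHy addr0.
rewrite [LHS](hom_component_hom wL g Mx).
rewrite (fsum_morph _ (gprojB (gmod_gr N) (k + g)) (ghom_eval_fin w x)).
apply: fsbig1 => h _; have [->|hg] := eqVneq h (psi g).
  by rewrite wg0 /= gproj0.
have /coarsen_compP -> // := grHom_gr (w h) (coarsen_comp_hom psi Mx).
by rewrite raddfD => /addrI /esym /eqP; rewrite (negbTE hg).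
Qed.

End CanonicalMorphismRange.

(** * Surjectivity of the canonical morphism *)

Section MainTheorem.
Variables (G H : zmodType) (psi : {additive G -> H}) (R : gradedRing G).

Lemma finite_fiber h : (exists g, psi g = h) ->
  finite_set (psi @^-1` [set 0]) -> finite_set (psi @^-1` [set h]).
Proof.
(* A nonempty fiber is a translate of the kernel. *)
move=> [g0 <-] /(finite_image (fun g => g + g0)); apply: sub_finite_set.
move=> g /= gg0; exists (g - g0); rewrite ?subrK //=.
by rewrite raddfB gg0 subrr.
Qed.

Lemma infinite_injection (T : Type) (A : set T) : infinite_set A ->
  exists2 k : nat -> T, injective k & forall n, A (k n).
Proof.
move=> /infiniteP/card_leP[f].
exists (fun n => val (f (to_setT n))) => [m n /val_inj fmn|n].
  have /(congr1 val) // : to_setT m = to_setT n.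
  by apply: ('inj_f _ _ fmn); rewrite inE.
by apply/set_mem/valP.
Qed.

Variable M : gradedModule R.

Lemma hpsi_surj_small N (w : ghom (coarsen_gmod psi M) (coarsen_gmod psi N)) :
  small M -> range (@hpsi_fun _ _ psi _ M N) w.
Proof.
move=> /smallP sM.
(* Coarsening keeps the underlying ring and modules, so linearity over the coarsened ring is
   linearity over R. *)
have wL : linear (ghom_eval w : M -> N) := ghom_eval_linear w.
apply/(hpsi_rangeP wL).
(* Pointwise finiteness of the components puts this family in the direct sum; smallness then makes
   the finiteness uniform in x. *)
pose u x : dsum_gmod (fun g => shift N g) := Dsum (hom_component_sum wL x).1.
have uL : linear u by move=> a x y; apply: dsumP => g; exact: grHom_linear.
have uG g x : gmod_gr M g x -> gmod_gr (dsum_gmod (fun g => shift N g)) g (u x).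
  by move=> Mx k; exact: grHom_gr.
have /finsuppP[r _ rf] := sM _ _ (GrHom uL uG).
apply: (@finsuppS _ r) => g /rf ug; apply: grHomP => x.
exact: (congr1 (fun v : grHom M (shift N g) => v x) ug).
Qed.

Lemma hpsi_surj_finite N (w : ghom (coarsen_gmod psi M) (coarsen_gmod psi N)) :
  (forall h, exists g, psi g = h) -> finite_set (psi @^-1` [set 0]) ->
  range (@hpsi_fun _ _ psi _ M N) w.
Proof.
move=> psi_surj fin_ker.
have wL : linear (ghom_eval w : M -> N) := ghom_eval_linear w.
apply/(hpsi_rangeP wL).
apply: (@sub_finite_set _ _
  (\bigcup_(h in [set h | w h != 0]) psi @^-1` [set h])).
  move=> g /= wg0; exists (psi g) => //=; apply: contra_neq wg0.
  exact: hom_component_coarsen_eq0.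
apply: bigcup_finite => [|h _]; first exact: dsum_fin.
exact: finite_fiber.
Qed.

(* If M is not small, some u : M -> (+)_i N_i has infinitely many nonzero
   components u_(j n). For distinct k n in Ker(psi), the sum of the u_(j n), as
   maps of degree k n into N_(j n)(-k n), has degree 0 for the H-gradings and
   infinitely many nonzero G-homogeneous components. *)
Lemma hpsi_surj_infinite_ker :
  (forall N w, range (@hpsi_fun _ _ psi _ M N) w) ->
  infinite_set (psi @^-1` [set 0]) -> small M.
Proof.
move=> hpsi_surj /infinite_injection[k kI kK]; apply/smallP => I N u.
apply: contrapT => /infinite_injection[j jI ju].
pose N' n := shift (N (j n)) (- k n).
have ff x : finsupp (fun n => (u x : dsum_gmod_sort N) (j n) : N' n).
  by apply: (finite_preimage _ (dsum_fin (u x : dsum_gmod_sort N)))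
    => m n _ _ /jI.
pose f x : dsum_gmod N' := Dsum (ff x).
have fL : linear f.
  by move=> a x y; apply: dsumP => n /=; rewrite (grHom_linear u).
(* The shift by 0 appears because w will be concentrated in degree 0 of the graded Hom module. *)
have fG h x : gmod_gr (coarsen_gmod psi M) h x ->
    gmod_gr (shift (coarsen_gmod psi (dsum_gmod N')) 0) h (f x).
  have fD y z : f (y + z) = f y + f z.
    by have := fL 1 y z; rewrite !scale1r.
  rewrite /= /shift_comp addr0.
  move: x; apply: (@coarsen_ind _ _ _ _ _ h
    (fun x => coarsen_comp psi (dsum_gmod_gr N') h (f x)))
    => [|x y Nx Ny|g x <- Mx].
  - have -> : f 0 = 0 by apply: (addrI (f 0)); rewrite -fD !addr0.
    exact: coarsen_comp0.
  - by rewrite fD; exact: coarsen_compD.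
  (* The n-th coordinate has degree g + k n, which psi sends to psi g because k n lies in the
     kernel. *)
  rewrite [f x]dsum_injs; apply: coarsen_comp_sum => n _.
  exists (g + k n); first by rewrite raddfD (kK n) addr0.
  apply: (dsum_gmod_inj_gr (N := N')).
  by rewrite /= /shift_comp addrK; exact: (grHom_gr u Mx (j n)).
pose f' : grHom (coarsen_gmod psi M)
    (shift (coarsen_gmod psi (dsum_gmod N')) 0) :=
  @GrHom H (coarsen_ring psi R) (coarsen_gmod psi M)
    (shift (coarsen_gmod psi (dsum_gmod N')) 0) f fL fG.
pose w : ghom (coarsen_gmod psi M) (coarsen_gmod psi (dsum_gmod N')) :=
  dsum_inj 0 f'.
have wE : ghom_eval w = f.
  apply/funext => x; rewrite /ghom_eval (@fsum1 _ _ 0) => [|h h0].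
    by rewrite dsum_inj_in.
  by rewrite dsum_inj_out.
have wL : linear (ghom_eval w : M -> dsum_gmod N') by rewrite wE.
have /(hpsi_rangeP wL) := hpsi_surj _ w.
(* For x of degree g, the n-th coordinate of f x is already homogeneous of degree g + k n, so the
   component of degree k n retains all of it. *)
have wkE n x : (hom_component wL (k n) x : dsum_gmod_sort N') n =
    (u x : dsum_gmod_sort N) (j n).
  move: x; apply: (gr_ind (X := gmod_gr M)) => [|x y IHx IHy|g x Mx].
  - by rewrite !grHom0.
  - by rewrite !grHomD [LHS]dsumDE IHx IHy.
  rewrite [hom_component _ _ _](hom_component_hom wL (k n) Mx) wE.
  rewrite -[LHS](gproj_grHom (dsum_gmod_coord N' n)).
  rewrite (@gproj_hom _ _ _ _ (g + k n)) ?eqxx //.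
  by rewrite /= /shift_comp addrK; exact: (grHom_gr u Mx (j n)).
(* Every [k n] lies in the finite support of the components of w, as [u] has a nonzero coordinate at
   [j n]; injectivity of k would make nat finite. *)
move=> /(finite_preimage (in2W kI)) wfin; apply: infinite_nat.
apply: sub_finite_set wfin => n _ /=; apply: contra_neq (ju n) => wkn0.
by apply: grHomP => x /=; rewrite -wkE wkn0.
Qed.

End MainTheorem.

Theorem mainTheorem2 (G H : zmodType) (psi : {additive G -> H})
    (psi_surj : forall h : H, exists g : G, psi g = h)
    (R : gradedRing G) (M : gradedModule R) :
  grNat_iso (hpsi psi M) <-> small M \/ finite_set (psi @^-1` [set 0]).
Proof.
(* The canonical morphism is always injective, so only surjectivity at each N is at stake. *)
have hpsi_bij : grNat_iso (hpsi psi M) <->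
    forall N w, range (@hpsi_fun _ _ psi _ M N) w.
  rewrite grNat_isoP; split=> [bij N w|surj N].
    by have [g _ gK] := bij N; exists (g w) => //; exact: gK.
  exact: inj_surj_bijective (@hpsi_inj _ _ psi R M N) (surj N).
rewrite hpsi_bij; split=> [surj|[sM|fin_ker] N w].
- have [fin_ker|inf_ker] := pselect (finite_set (psi @^-1` [set 0])).
    by right.
  by left; exact: hpsi_surj_infinite_ker surj inf_ker.
- exact: hpsi_surj_small.
- exact: hpsi_surj_finite.
Qed.
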